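(* Let $n,p\in\mathbb N$, let $\delta$ be a positive infinitesimal and $\tau=\tau^\delta$. Suppose that $[h]\in\mathcal G^0_{p,p,0}$. Then left composition $lc_{[h]}:\mathcal G^0_{n,p,0}\to\mathcal G^0_{n,p,0}$, $[f]\mapsto[h\circ f]$, is a continuous map with respect to $\tau$.
   Context: Work in a sufficiently saturated nonstandard extension ${}^*$ of a superstructure over $\mathbb R$. $B_\delta=\{\xi\in{}^*\mathbb R^n:|\xi|\le\delta\}$. $\mathcal G_0$ is the ring of germs at $0\in\mathbb R^n$ of functions $f:(\mathbb R^n,0)\to(\mathbb R,0)$. $\mathcal G_{n,p,0}$ is the set of germs at $0$ of maps $(\mathbb R^n,0)\to(\mathbb R^p,0)$ and $\mathcal G^0_{n,p,0}$ the subset of germs of continuous maps. $\|{}^*f\|_\delta={}^*\sup\{|{}^*f(\xi)|:\xi\in B_\delta\}$; $\mathcal N_\delta=\{\|{}^*g\|_\delta:[g]\in\mathcal G_0\}$; for $\mathfrak r\in\mathcal N_\delta$, $\mathfrak r>0$, $U^\delta_{\mathfrak r}=\{[f]\in\mathcal G_0:\|{}^*f\|_\delta<\mathfrak r\}$. $\tau^\delta$ is the topology on $\mathcal G_0$ generated by all translates $[f]+U^\delta_{\mathfrak r}$. $\mathcal G_{n,p,0}$, identified with the $p$-fold Cartesian product of $\mathcal G_0$, has the product topology, and $\mathcal G^0_{n,p,0}$ the subspace topology (both again denoted $\tau$). *)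

(* Defs.v *)
From HB Require Import structures.
From mathcomp Require Import all_boot all_order all_algebra.
From mathcomp Require Import all_classical all_reals all_analysis.
Set Implicit Arguments.
Unset Strict Implicit.
Unset Printing Implicit Defensive.
Import Order.TTheory GRing.Theory Num.Theory.
Import numFieldNormedType.Exports.
Local Open Scope classical_set_scope.
Local Open Scope ring_scope.
Local Open Scope quotient_scope.

(** The superstructure over [X] is the union of the levels [V_0 = X] and
    [V_(k+1) = V_k `|` P(V_k)], where the elements of [X] are urelements.
    [superstructure X] axiomatizes it up to isomorphism: sets are extensional,
    every entity lies in some level, and every subcollection of a level is a
    set. *)

Fixpoint level (X V : Type) (mem : V -> V -> Prop) (atom : X -> V)
    (k : nat) (a : V) : Prop :=
  if k is k'.+1 then
    level mem atom k' a \/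
    ((forall x, a <> atom x) /\ forall b, mem b a -> level mem atom k' b)
  else exists x, a = atom x.

Record superstructure (X : Type) := Superstructure {
  entity :> Type;
  smem : entity -> entity -> Prop;
  atom : X -> entity;
  atom_inj : injective atom;
  atom_empty : forall x a, ~ smem a (atom x);
  smem_ext : forall a b, (forall x, a <> atom x) -> (forall x, b <> atom x) ->
    (forall c, smem c a <-> smem c b) -> a = b;
  level_ex : forall a, exists k, level smem atom k a;
  smem_compr : forall k (A : set entity), (forall a, A a -> level smem atom k a) ->
    exists b, (forall x, b <> atom x) /\ forall a, smem a b <-> A a }.

Section Encodings.
Variables (X : Type) (V : superstructure X).
Implicit Types (a b : V) (A : set V).

Lemma empty_ex : exists b, (forall x, b <> atom V x) /\ forall a, ~ smem a b.
Proof.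
have [|b [bx bE]] := @smem_compr X V 0 set0; first by [].
by exists b; split => // a /bE.
Qed.

Definition vempty : V := projT1 (cid empty_ex).

(* Definite description; the value is irrelevant when nothing satisfies [A]. *)
Definition the A : V :=
  if pselect (exists a, A a) is left h then projT1 (cid h) else vempty.

(* The set with elements [A], meaningful whenever [A] is contained in a level. *)
Definition vset A : V :=
  the [set b | (forall x, b <> atom V x) /\ forall a, smem a b <-> A a].

Definition vpair a b : V := vset [set vset [set a]; vset [set a; b]].

(* Value at [a] of the function whose graph is [F]. *)
Definition vapp (F a : V) : V := the [set b | smem (vpair a b) F].

End Encodings.

(* Formulas of the language of set theory with bounded quantifiers only:
   [BAll i j phi] is "for all x_i in x_j, phi". *)
Inductive bformula :=
| BEq of nat & nat
| BMem of nat & nat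
| BNot of bformula
| BAnd of bformula & bformula
| BAll of nat & nat & bformula.

Fixpoint holds (X : Type) (V : superstructure X) (e : nat -> V) (phi : bformula)
    : Prop :=
  match phi with
  | BEq i j => e i = e j
  | BMem i j => smem (e i) (e j)
  | BNot phi => ~ holds e phi
  | BAnd phi psi => holds e phi /\ holds e psi
  | BAll i j phi =>
      forall a, smem a (e j) -> holds (fun k => if k == i then a else e k) phi
  end.

(* [Y] is the set of urelements *X of the target superstructure. *)
Record nonstandard_extension (X Y : Type)
    (V : superstructure X) (W : superstructure Y) := NonstandardExtension {
  star :> V -> W;
  star_base : star (vset (range (atom V))) = vset (range (atom W));
  transfer : forall (phi : bformula) (e : nat -> V),
    holds e phi <-> holds (star \o e) phi }.

Definition internal (X Y : Type) (V : superstructure X) (W : superstructure Y)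
    (S : nonstandard_extension V W) (a : W) : Prop :=
  exists b : V, smem a (S b).

(* Families of internal sets indexed by [I] with the finite intersection
   property have nonempty intersection. *)
Definition saturated (X Y : Type) (V : superstructure X) (W : superstructure Y)
    (S : nonstandard_extension V W) (I : Type) : Prop :=
  forall F : I -> W, (forall i, internal S (F i)) ->
    (forall m (j : 'I_m -> I), exists a, forall k, smem a (F (j k))) ->
    exists a, forall i, smem a (F i).

Section StandardObjects.
Variables (R : realType) (V : superstructure R).

(* A point of R^n is the function from {0, ..., n-1} to R given by its graph. *)
Definition vpoint n (x : 'rV[R]_n) : V :=
  vset [set vpair (atom V i%:R) (atom V (x 0 i)) | i in [set: 'I_n]].

Definition vspace n : V := vset (range (@vpoint n)).

Definition vgraph n (f : 'rV[R]_n -> R) : V :=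
  vset [set vpair (vpoint x) (atom V (f x)) | x in [set: 'rV[R]_n]].

(* The library norm on ['rV_n] is the sup norm, hence this definition. *)
Definition enorm n (x : 'rV[R]_n) : R := Num.sqrt (\sum_(i < n) x 0 i ^+ 2).

Definition vabs : V :=
  vset [set vpair (atom V x) (atom V `|x|) | x in [set: R]].

(* The infinite values are represented by two entities that are not atoms. *)
Definition vext (x : \bar R) : V :=
  match x with
  | EFin r => atom V r
  | +oo%E => vempty V
  | -oo%E => vset [set vempty V]
  end.

Definition vrel (r : rel (\bar R)) : V :=
  vset [set vpair (vext xy.1) (vext xy.2) | xy in [set xy | r xy.1 xy.2]].

Definition vsup : V :=
  vset [set vpair (vset (atom V @` A)) (vext (ereal_sup (EFin @` A)))
       | A in [set: set R]].

End StandardObjects.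

Section Germs.
Variables (R : realType) (n : nat).

(* Every germ of a map (R^n, 0) -> (T, 0) has a representative defined on the
   whole of R^n. *)
Definition pmap (T : zmodType) := {f : 'rV[R]_n -> T | `[< f 0 = 0 >]}.

Lemma pmap0 (T : zmodType) (f : pmap T) : val f 0 = 0.
Proof. exact/asboolP/(valP f). Qed.

Definition Pmap (T : zmodType) (f : 'rV[R]_n -> T) (f0 : f 0 = 0) : pmap T :=
  exist _ f (asboolT f0).

Definition same_germ (T : zmodType) (f g : pmap T) : bool :=
  `[< \forall x \near (0 : 'rV[R]_n), val f x = val g x >].

Lemma same_germ_refl (T : zmodType) : reflexive (@same_germ T).
Proof. by move=> f; apply/asboolP; exact: (@filterE _ (nbhs (0 : 'rV[R]_n))). Qed.

Lemma same_germ_sym (T : zmodType) : symmetric (@same_germ T).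
Proof.
by move=> f g; apply/asboolP/asboolP; apply: filterS.
Qed.

Lemma same_germ_trans (T : zmodType) : transitive (@same_germ T).
Proof.
move=> g f h /asboolP fg /asboolP gh; apply/asboolP.
by apply: filterS2 fg gh => x -> ->.
Qed.

Canonical germ_equiv (T : zmodType) :=
  EquivRel (@same_germ T) (@same_germ_refl T) (@same_germ_sym T)
           (@same_germ_trans T).

Definition germ (T : zmodType) := {eq_quot (germ_equiv T)}.

HB.instance Definition _ (T : zmodType) := Choice.on (germ T).
HB.instance Definition _ (T : zmodType) := EqQuotient.on (germ T).

Definition germ_of (T : zmodType) (f : pmap T) : germ T := \pi_(germ T) f.

Lemma germ_ofP (T : zmodType) (f g : pmap T) :
  germ_of f = germ_of g <-> \forall x \near (0 : 'rV[R]_n), val f x = val g x.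
Proof.
split=> [/eqquotP/asboolP //|fg]; exact/eqquotP/asboolP.
Qed.

Lemma germ_of_repr (T : zmodType) (g : germ T) : germ_of (repr g) = g.
Proof. exact: reprK. Qed.

Lemma repr_germ_of (T : zmodType) (f : pmap T) :
  \forall x \near (0 : 'rV[R]_n), val (repr (germ_of f)) x = val f x.
Proof. by apply/germ_ofP; rewrite germ_of_repr. Qed.

Lemma padd_subproof (T : zmodType) (f g : pmap T) : val f 0 + val g 0 = 0.
Proof. by rewrite !pmap0 addr0. Qed.

Definition padd (T : zmodType) (f g : pmap T) : pmap T :=
  @Pmap T (fun x => val f x + val g x) (padd_subproof f g).

Definition germ_add (T : zmodType) (a b : germ T) : germ T :=
  germ_of (padd (repr a) (repr b)).

Lemma germ_addE (T : zmodType) (f g : pmap T) :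
  germ_add (germ_of f) (germ_of g) = germ_of (padd f g).
Proof.
apply/germ_ofP => /=.
by apply: filterS2 (repr_germ_of f) (repr_germ_of g) => x -> ->.
Qed.

Lemma pcoord_subproof p (f : pmap 'rV[R]_p) (i : 'I_p) : val f 0 0 i = 0.
Proof. by rewrite pmap0 mxE. Qed.

Definition pcoord p (f : pmap 'rV[R]_p) (i : 'I_p) : pmap R :=
  @Pmap R (fun x => val f x 0 i) (pcoord_subproof f i).

Definition germ_coord p (g : germ 'rV[R]_p) (i : 'I_p) : germ R :=
  germ_of (pcoord (repr g) i).

Lemma germ_coordE p (f : pmap 'rV[R]_p) (i : 'I_p) :
  germ_coord (germ_of f) i = germ_of (pcoord f i).
Proof. by apply/germ_ofP => /=; apply: filterS (repr_germ_of f) => x ->. Qed.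

Definition continuous_pmap p (f : pmap 'rV[R]_p) : Prop :=
  \forall x \near (0 : 'rV[R]_n), {for x, continuous (val f)}.

Definition continuous_germ p (g : germ 'rV[R]_p) : Prop :=
  exists2 f, g = germ_of f & continuous_pmap f.

Lemma continuous_germ_of p (f : pmap 'rV[R]_p) :
  continuous_germ (germ_of f) <-> continuous_pmap f.
Proof.
split=> [[g /germ_ofP fg cg]|]; last by exists f.
apply: filterS2 cg (nbhs_interior fg) => x gx fgx.
rewrite /prop_for /continuous_at (nbhs_singleton fgx).
apply: cvg_trans gx; apply: (@near_eq_cvg _ _ (nbhs (x : 'rV[R]_n))).
by apply: (@filterS _ (nbhs (x : 'rV[R]_n))) fgx => y ->.
Qed.

End Germs.

Section Composition.
Variables (R : realType) (n p q : nat).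

Lemma pcomp_subproof (h : pmap R p 'rV[R]_q) (f : pmap R n 'rV[R]_p) :
  val h (val f 0) = 0.
Proof. by rewrite !pmap0. Qed.

Definition pcomp (h : pmap R p 'rV[R]_q) (f : pmap R n 'rV[R]_p) :
    pmap R n 'rV[R]_q :=
  @Pmap R n _ (fun x => val h (val f x)) (pcomp_subproof h f).

Definition germ_comp (h : germ R p 'rV[R]_q) (f : germ R n 'rV[R]_p) :
    germ R n 'rV[R]_q :=
  germ_of (pcomp (repr h) (repr f)).

Lemma pmap_cvg0 (f : pmap R n 'rV[R]_p) :
  continuous_pmap f -> val f x @[x --> (0 : 'rV[R]_n)] --> (0 : 'rV[R]_p).
Proof.
by move=> /nbhs_singleton; rewrite /prop_for /continuous_at pmap0.
Qed.

Lemma germ_compE (h : pmap R p 'rV[R]_q) (f : pmap R n 'rV[R]_p) :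
  continuous_pmap f -> germ_comp (germ_of h) (germ_of f) = germ_of (pcomp h f).
Proof.
move=> cf; apply/germ_ofP => /=.
have hf := pmap_cvg0 cf (repr_germ_of h).
by apply: filterS2 (repr_germ_of f) hf => x -> /=.
Qed.

Lemma continuous_pcomp (h : pmap R p 'rV[R]_q) (f : pmap R n 'rV[R]_p) :
  continuous_pmap h -> continuous_pmap f -> continuous_pmap (pcomp h f).
Proof.
move=> ch cf; have hf := pmap_cvg0 cf ch.
apply: filterS2 cf hf => x fx hx.
exact: (@continuous_comp _ _ _ (val f) (val h)).
Qed.

Lemma continuous_germ_comp (h : germ R p 'rV[R]_q) (f : germ R n 'rV[R]_p) :
  continuous_germ h -> continuous_germ f -> continuous_germ (germ_comp h f).
Proof.
move=> [h' -> ch] [f' -> cf]; rewrite (germ_compE _ cf).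
exact/continuous_germ_of/continuous_pcomp.
Qed.

End Composition.

Section Tau.
Variables (R : realType) (Y : Type).
Variables (V : superstructure R) (W : superstructure Y).
Variable S : nonstandard_extension V W.

Definition star_lt (a b : W) : Prop :=
  smem (vpair a b) (S (vrel V <%O)).

Definition star_le (a b : W) : Prop :=
  smem (vpair a b) (S (vrel V <=%O)).

Definition positive_infinitesimal (d : Y) : Prop :=
  star_lt (S (atom V 0)) (atom W d) /\
  forall r : R, 0 < r -> star_lt (atom W d) (S (atom V r)).

Variable d : Y.

Definition star_ball n : set W :=
  [set xi | smem xi (S (vspace V n)) /\
     star_le (vapp (S (vgraph V (@enorm R n))) xi) (atom W d)].

(* The *sup takes its values in the extended hyperreals, so that the norm of
   every germ, bounded or not, is defined. *)
Definition star_norm n (f : 'rV[R]_n -> R) : W :=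
  vapp (S (vsup V))
    (vset [set vapp (S (vabs V)) (vapp (S (vgraph V f)) xi)
          | xi in star_ball n]).

Definition norm_values n : set W :=
  [set star_norm (val g) | g in [set: pmap R n R]].

Definition germ_nbhd n (r : W) : set (germ R n R) :=
  [set germ_of f | f in [set f : pmap R n R | star_lt (star_norm (val f)) r]].
Arguments germ_nbhd : clear implicits.

Definition tau_subbase n : set (set (germ R n R)) :=
  [set A | exists f r, [/\ norm_values n r, star_lt (S (atom V 0)) r &
     A = [set germ_add f g | g in germ_nbhd n r]]].
Arguments tau_subbase : clear implicits.

End Tau.

Arguments tau_subbase {R Y V W} S d n _.

Section TauSpaces.
Variables (R : realType) (Y : Type).
Variables (V : superstructure R) (W : superstructure Y).

(* [S] and [d] do not occur in the carrier: they select the topology. *)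
Definition G0 (S : nonstandard_extension V W) (d : Y) (n : nat) : Type :=
  germ R n R.

HB.instance Definition _ S d n := Choice.on (G0 S d n).
HB.instance Definition _ S d n :=
  @isSubBaseTopological.Build (G0 S d n) (set (germ R n R))
    (tau_subbase S d n) id.

Variables (S : nonstandard_extension V W) (d : Y).

(* The product topology, carried along the identification of a germ with the
   family of its coordinates. *)
Definition Gmap n p : Type :=
  initial_topology
    (@germ_coord R n p : germ R n 'rV[R]_p ->
                         prod_topology (fun _ : 'I_p => G0 S d n)).
HB.instance Definition _ n p := Topological.on (Gmap n p).

Definition Gcont n p : set (Gmap n p) := [set g | continuous_germ g].
Arguments Gcont : clear implicits.

Definition lcomp n p (h : Gcont p p) (f : Gcont n p) : Gcont n p :=
  exist _ (germ_comp (val h) (val f))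
    (mem_set (continuous_germ_comp (set_valP h) (set_valP f))).

End TauSpaces.

Arguments Gcont {R Y V W} S d n p _.

(* Main.v *)
(** For standard functions [f] and [g], transfer turns ||*f||_d < ||*g||_d into
    the statement that [d] lies in the extension of the set of real radii [t]
    with ||f||_t < ||g||_t, so the topology is governed by real inequalities
    holding on such sets of radii.

    The obvious epsilon-delta argument fails, because the values of N_d need not
    be coinitial in the positive hyperreals.  Let ||g|| = s < r = ||g0|| express
    that [h o f] lies in a subbasic open set.  The gap r - s is encoded by
    countably many rationals q_m separating s(t) from r(t) for some radius t.
    Since s and r are monotone in t, one e_m > 0 bounds r(t) - |g x| from below
    whenever |g x| < q_m < r(t) and |x| <= t.  Weighting q_m by a summable
    multiple of the modulus of continuity of h at e_m and summing over
    q_m <= |g x|, respectively q_m < r(|x|), gives standard functions [a] and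
    [b] with ||a||_t < ||b||_t whenever s(t) < r(t), and such that
    |u| + |a x| < ||b||_t makes the variation of h under the displacement u
    smaller than the gap.  The neighbourhoods of f are then the intersections,
    over the coordinates f_j, of the translates of U_||b|| by f_j + a and
    by f_j - a. *)

Require Import Defs.
From mathcomp Require Import finmap.
From mathcomp Require Import all_boot all_order all_algebra.
From mathcomp Require Import lra zify.
From mathcomp Require Import all_classical all_reals all_analysis.
(* Re-imported because [seq] also defines [pmap] and [ssrfun] also [pcomp]. *)
Import Defs.
Set Implicit Arguments.
Unset Strict Implicit.
Unset Printing Implicit Defensive.
Import Order.TTheory GRing.Theory Num.Theory.
Import numFieldNormedType.Exports.
Local Open Scope classical_set_scope.
Local Open Scope ring_scope.

(** * Sets in a superstructure *)

Section Sets.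
Variables (X : Type) (V : superstructure X).
Implicit Types (a b c F : V) (A : set V).

Definition bounded_in k A := forall a, A a -> level (@smem X V) (atom V) k a.

Definition is_set a := forall x, a <> atom V x.

Lemma levelS k a :
  level (@smem X V) (atom V) k a -> level (@smem X V) (atom V) k.+1 a.
Proof. by move=> ka; left. Qed.

Lemma level_add k m a :
  level (@smem X V) (atom V) k a -> level (@smem X V) (atom V) (k + m) a.
Proof. by move=> ka; elim: m => [|m]; rewrite ?addn0// addnS => /levelS. Qed.

Lemma smem_set a b : smem a b -> is_set b.
Proof. by move=> ab x E; apply: (@atom_empty X V x a); rewrite -E. Qed.

Lemma the_unique A a : A a -> (forall b, A b -> b = a) -> the A = a.
Proof.
move=> Aa uA; rewrite /the; case: pselect => [h|]; last by case; exists a.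
by case: cid => b /= /uA.
Qed.

(** Comprehension is available only inside a level; extensionality then makes the set unique, so the
    description [the] in [vset] finds it. *)
Lemma vset_prop k A : bounded_in k A ->
  is_set (vset A) /\ forall a, smem a (vset A) <-> A a.
Proof.
move=> kA; have [b [bs bE]] := smem_compr kA.
suff -> : vset A = b by [].
apply: the_unique => // c [cs cE]; apply: smem_ext => // a.
by rewrite cE bE.
Qed.

Lemma in_vset k A a : bounded_in k A -> smem a (vset A) <-> A a.
Proof. by move=> /vset_prop[]. Qed.

Lemma vset_is_set k A : bounded_in k A -> is_set (vset A).
Proof. by move=> /vset_prop[]. Qed.

Lemma vset_eq k A b : bounded_in k A -> is_set b ->
  (forall a, smem a b <-> A a) -> vset A = b.
Proof.
move=> kA bs bE; have [As AE] := vset_prop kA.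
by apply: smem_ext => // a; rewrite AE bE.
Qed.

Lemma level_vset k A : bounded_in k A ->
  level (@smem X V) (atom V) k.+1 (vset A).
Proof.
by move=> kA; right; split=> [|a /(in_vset _ kA)/kA//]; exact: vset_is_set kA.
Qed.

Lemma bounded_finite2 a b : exists k, bounded_in k [set a; b].
Proof.
have [i ai] := level_ex a; have [j bj] := level_ex b.
exists (i + j)%N => c [->|->]; first exact: level_add.
by rewrite addnC; exact: level_add.
Qed.

Lemma bounded_finite1 a : exists k, bounded_in k [set a].
Proof. by have [k ka] := level_ex a; exists k => c ->. Qed.

Lemma in_vset2 a b c : smem c (vset [set a; b]) <-> c = a \/ c = b.
Proof. have [k kA] := bounded_finite2 a b; exact: in_vset kA. Qed.

Lemma in_vset1 a c : smem c (vset [set a]) <-> c = a.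
Proof. have [k kA] := bounded_finite1 a; exact: in_vset kA. Qed.

Lemma in_vpair a b c :
  smem c (vpair a b) <-> c = vset [set a] \/ c = vset [set a; b].
Proof. exact: in_vset2. Qed.

Lemma vset1_is_set a : is_set (vset [set a]).
Proof. have [k kA] := bounded_finite1 a; exact: vset_is_set kA. Qed.

Lemma vset2_is_set a b : is_set (vset [set a; b]).
Proof. have [k kA] := bounded_finite2 a b; exact: vset_is_set kA. Qed.

(** Every quantifier on the right ranges over [c] or over an element of [c], so being an ordered
    pair is a bounded condition; [BIsPair] copies it clause by clause. *)
Lemma vpairP a b c : c = vpair a b <->
  exists2 u, smem u c & exists2 v, smem v c &
  (forall w, smem w c -> w = u \/ w = v) /\
  ((smem a u /\ forall w, smem w u -> w = a) /\
  (smem a v /\ smem b v /\ forall w, smem w v -> w = a \/ w = b)).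
Proof.
split=> [->|[u uc [v vc [cE [[au uE] [av [bv vE]]]]]]].
  exists (vset [set a]); first by apply/in_vpair; left.
  exists (vset [set a; b]); first by apply/in_vpair; right.
  split=> [w /in_vpair//|]; split; split; rewrite ?in_vset1 ?in_vset2; auto.
    by move=> w /in_vset1.
  by split; rewrite ?in_vset2; auto => w /in_vset2.
have uE' : u = vset [set a].
  apply: smem_ext; [exact: smem_set au | exact: vset1_is_set |] => w.
  by rewrite in_vset1; split=> [/uE//|->].
have vE' : v = vset [set a; b].
  apply: smem_ext; [exact: smem_set av | exact: vset2_is_set |] => w.
  by rewrite in_vset2; split=> [/vE//|[]->].
apply: smem_ext; [exact: smem_set uc | exact: vset2_is_set |] => w.
by rewrite in_vpair -uE' -vE'; split=> [/cE//|[]->].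
Qed.

Lemma vpair_inj a b a' b' : vpair a b = vpair a' b' -> a = a' /\ b = b'.
Proof.
move=> E.
have mE c : (c = vset [set a] \/ c = vset [set a; b]) <->
            (c = vset [set a'] \/ c = vset [set a'; b']).
  by rewrite -!in_vpair E.
have aa : a = a'.
  have [/(_ (or_introl erefl)) H _] := mE (vset [set a]).
  have : smem a' (vset [set a]).
    by case: H => ->; rewrite ?in_vset1 ?in_vset2; auto.
  by rewrite in_vset1.
split=> //; subst a'.
have [/(_ (or_intror erefl)) H _] := mE (vset [set a; b]).
have [_ /(_ (or_intror erefl)) H'] := mE (vset [set a; b']).
have bE : b = a \/ b = b'.
  have : smem b (vset [set a; b]) by rewrite in_vset2; right.
  by case: H => ->; rewrite ?in_vset1 ?in_vset2; auto.
have bE' : b' = a \/ b' = b.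
  have : smem b' (vset [set a; b']) by rewrite in_vset2; right.
  by case: H' => ->; rewrite ?in_vset1 ?in_vset2; auto.
by case: bE bE' => [->|->]// [->|->].
Qed.

Lemma level_vpair k a b : level (@smem X V) (atom V) k a ->
  level (@smem X V) (atom V) k b -> level (@smem X V) (atom V) k.+2 (vpair a b).
Proof.
move=> ka kb; apply: level_vset => c [->|->]; apply: level_vset.
  by move=> _ ->.
by move=> _ [] ->.
Qed.

Lemma level_atom k x : level (@smem X V) (atom V) k (atom V x).
Proof. by rewrite -[k]add0n; apply: level_add; exists x. Qed.

Definition vatoms := vset (range (atom V)).

Lemma in_vatoms a : smem a vatoms <-> exists x, a = atom V x.
Proof.
have bR : bounded_in 0 (range (atom V)) by move=> _ [x _ <-]; exact: level_atom.
by rewrite (in_vset _ bR); split=> [[x _ <-]|[x ->]]; exists x.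
Qed.

(** All quantifiers are bounded by [F], [D] or [C], so that the notion transfers. *)
Definition vfunction F D C :=
  (forall c, smem c F -> exists2 x, smem x D & exists2 y, smem y C &
     c = vpair x y) /\
  (forall x, smem x D -> exists2 y, smem y C & smem (vpair x y) F) /\
  (forall x, smem x D -> forall y, smem y C -> forall y', smem y' C ->
     smem (vpair x y) F -> smem (vpair x y') F -> y = y').

Section Vapp.
Variables (F D C : V).
Hypothesis FDC : vfunction F D C.

Lemma vfunction_dom x y : smem (vpair x y) F -> smem x D /\ smem y C.
Proof.
by move=> /(proj1 FDC)[x' xD [y' yC /vpair_inj[-> ->]]].
Qed.

Lemma vapp_eq x y : smem (vpair x y) F -> vapp F x = y.
Proof.
move=> xy; have [xD yC] := vfunction_dom xy.
apply: the_unique => //= z xz; have [_ zC] := vfunction_dom xz.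
exact: (proj2 (proj2 FDC)) xz xy.
Qed.

Lemma vappP x : smem x D -> smem (vapp F x) C /\ smem (vpair x (vapp F x)) F.
Proof.
move=> xD; have [y yC xy] := (proj1 (proj2 FDC)) x xD.
by rewrite (vapp_eq xy).
Qed.

End Vapp.
End Sets.

(** * Bounded formulas with ordered pairs *)

Inductive formula :=
| FEq of nat & nat
| FMem of nat & nat
| FIsPair of nat & nat & nat
| FPair of nat & nat & nat
| FNot of formula
| FAnd of formula & formula
| FImp of formula & formula
| FAll of nat & nat & formula
| FEx of nat & nat & formula.

Section Sat.
Variables (X : Type) (V : superstructure X).

(** [eqn] computes on literal indices, and it is convertible to the [==] occurring in [holds]. *)
Definition upd (e : nat -> V) i a k := if eqn k i then a else e k.

Fixpoint sat (e : nat -> V) (phi : formula) : Prop :=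
  match phi with
  | FEq i j => e i = e j
  | FMem i j => smem (e i) (e j)
  | FIsPair c i j => e c = vpair (e i) (e j)
  | FPair i j k => smem (vpair (e i) (e j)) (e k)
  | FNot phi => ~ sat e phi
  | FAnd phi psi => sat e phi /\ sat e psi
  | FImp phi psi => sat e phi -> sat e psi
  | FAll i j phi => forall a, smem a (e j) -> sat (upd e i a) phi
  | FEx i j phi => exists2 a, smem a (e j) & sat (upd e i a) phi
  end.
End Sat.

Definition BImp phi psi := BNot (BAnd phi (BNot psi)).
Definition BOr phi psi := BNot (BAnd (BNot phi) (BNot psi)).
Definition BEx i j phi := BNot (BAll i j (BNot phi)).

(** The bound variables [u], [v], [w] exceed [c], [i] and [j], so nothing is captured. *)
Definition BIsPair c i j :=
  let u := (c + i + j).+1 in let v := u.+1 in let w := v.+1 in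
  BEx u c (BEx v c (BAnd (BAll w c (BOr (BEq w u) (BEq w v)))
    (BAnd (BAnd (BMem i u) (BAll w u (BEq w i)))
       (BAnd (BMem i v) (BAnd (BMem j v)
         (BAll w v (BOr (BEq w i) (BEq w j)))))))).

(** For [FPair i j k] the pair is sought among the elements of the [k]-th variable, which keeps the
    quantifier bounded. *)
Fixpoint bform (phi : formula) : bformula :=
  match phi with
  | FEq i j => BEq i j
  | FMem i j => BMem i j
  | FIsPair c i j => BIsPair c i j
  | FPair i j k => let c := (i + j + k).+1 in BEx c k (BIsPair c i j)
  | FNot phi => BNot (bform phi)
  | FAnd phi psi => BAnd (bform phi) (bform psi)
  | FImp phi psi => BImp (bform phi) (bform psi)
  | FAll i j phi => BAll i j (bform phi)
  | FEx i j phi => BEx i j (bform phi)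
  end.

Section BformP.
Variables (X : Type) (V : superstructure X).
Implicit Types e : nat -> V.

Lemma holds_imp e phi psi :
  holds e (BImp phi psi) <-> (holds e phi -> holds e psi).
Proof.
split=> [/= H h|H [/= h /(_ (H h))//]].
by apply: contrapT => nh; apply: H.
Qed.

Lemma holds_or e phi psi :
  holds e (BOr phi psi) <-> holds e phi \/ holds e psi.
Proof.
split=> [/= H|/= [h|h] []//].
have [?|?] := pselect (holds e phi); [by left|right].
by apply: contrapT => ?; apply: H.
Qed.

Lemma holds_and e phi psi :
  holds e (BAnd phi psi) <-> holds e phi /\ holds e psi.
Proof. by []. Qed.

Lemma holds_all e i j phi :
  holds e (BAll i j phi) <-> forall a, smem a (e j) -> holds (upd e i a) phi.
Proof. by []. Qed.

Lemma holds_ex e i j phi :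
  holds e (BEx i j phi) <-> exists2 a, smem a (e j) & holds (upd e i a) phi.
Proof.
split=> [/= H|/= [a aj ha] /(_ _ aj)//].
by apply: contrapT => nh; apply: H => a aj ha; apply: nh; exists a.
Qed.

Lemma updE e i a : upd e i a i = a.
Proof. by rewrite /upd; case: eqnP. Qed.

Lemma updN e i j a : j != i -> upd e i a j = e j.
Proof. by rewrite /upd => /eqP; case: eqnP. Qed.


Lemma ex2_iff (T : Type) (P P' Q Q' : T -> Prop) :
  (forall a, P a <-> P' a) -> (forall a, Q a <-> Q' a) ->
  (exists2 a, P a & Q a) <-> (exists2 a, P' a & Q' a).
Proof. by move=> PP QQ; split=> -[a /PP ? /QQ ?]; exists a. Qed.

Lemma all_iff (T : Type) (P P' Q Q' : T -> Prop) :
  (forall a, P a <-> P' a) -> (forall a, Q a <-> Q' a) ->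
  (forall a, P a -> Q a) <-> (forall a, P' a -> Q' a).
Proof. by move=> PP QQ; split=> H a /PP/H/QQ. Qed.

Lemma and_iff (P P' Q Q' : Prop) :
  (P <-> P') -> (Q <-> Q') -> P /\ Q <-> P' /\ Q'.
Proof. by tauto. Qed.

Lemma holds_pair e c i j : holds e (BIsPair c i j) <-> e c = vpair (e i) (e j).
Proof.
rewrite vpairP /BIsPair; set u := (c + i + j).+1.
have [cu iu ju] : [/\ (c < u)%N, (i < u)%N & (j < u)%N].
  by rewrite /u !ltnS; split; lia.
have U (f : nat -> V) k a : (k < u)%N -> upd f u a k = f k.
  by move=> ku; rewrite updN//; lia.
have U1 (f : nat -> V) k a : (k < u.+1)%N -> upd f u.+1 a k = f k.
  by move=> ku; rewrite updN//; lia.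
have U2 (f : nat -> V) k a : (k < u.+2)%N -> upd f u.+2 a k = f k.
  by move=> ku; rewrite updN//; lia.
(* [UE] evaluates every chain of updates met below; [side] discharges its index conditions. *)
have UE := (updE, U2 _ u.+1, U2 _ u, U2 _ c, U2 _ i, U2 _ j, U1 _ u, U1 _ c,
  U1 _ i, U1 _ j, U _ c, U _ i, U _ j).
have [[u1 u2 c1 c2] [i1 i2 j1 j2]] :
    [/\ (u < u.+1)%N, (u < u.+2)%N, (c < u.+1)%N & (c < u.+2)%N] /\
    [/\ (i < u.+1)%N, (i < u.+2)%N, (j < u.+1)%N & (j < u.+2)%N].
  by split; split; lia.
have side := (cu, iu, ju, u1, u2, c1, c2, (i1, i2, j1, j2)).
rewrite holds_ex; apply: ex2_iff => a; first by rewrite ?UE ?side ?ltnSn.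
rewrite holds_ex; apply: ex2_iff => b; first by rewrite ?UE ?side ?ltnSn.
rewrite holds_and; apply: and_iff.
  rewrite holds_all; apply: all_iff => w; first by rewrite ?UE ?side ?ltnSn.
  by rewrite holds_or /= ?UE ?side ?ltnSn.
rewrite holds_and; apply: and_iff; rewrite holds_and;
  (apply: and_iff; first by rewrite /= ?UE ?side ?ltnSn).
  by rewrite holds_all; apply: all_iff => w; rewrite /= ?UE ?side ?ltnSn.
rewrite holds_and; apply: and_iff; first by rewrite /= ?UE ?side ?ltnSn.
rewrite holds_all; apply: all_iff => w; first by rewrite ?UE ?side ?ltnSn.
by rewrite holds_or /= ?UE ?side ?ltnSn.
Qed.

Lemma eq_sat e e' phi : e =1 e' -> sat e phi <-> sat e' phi.
Proof.
elim: phi e e' => /= [i j|i j|c i j|i j k|phi IH|phi IH psi IH'|phi IH psi IH'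
  |i j phi IH|i j phi IH] e e' ee; rewrite -?ee //.
- by rewrite (IH _ _ ee).
- by rewrite (IH _ _ ee) (IH' _ _ ee).
- by rewrite (IH _ _ ee) (IH' _ _ ee).
- by apply: all_iff => // a; apply: IH => k; rewrite /upd ee.
- by apply: ex2_iff => // a; apply: IH => k; rewrite /upd ee.
Qed.

Lemma holds_bform e phi : holds e (bform phi) <-> sat e phi.
Proof.
elim: phi e => [i j|i j|c i j|i j k|phi IH|phi IH psi IH'|phi IH psi IH'
  |i j phi IH|i j phi IH] e.
- by [].
- by [].
- exact: holds_pair.
- set c := (i + j + k).+1.
  rewrite -[holds _ _]/(holds e (BEx c k (BIsPair c i j))) holds_ex.
  rewrite -[sat _ _]/(smem (vpair (e i) (e j)) (e k)); split=> [[a ak]|ij].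
    rewrite holds_pair updE !updN; [by move=> <-|lia|lia].
  by exists (vpair (e i) (e j)) => //; rewrite holds_pair updE !updN// /c; lia.
- by rewrite /= IH.
- by rewrite /= IH IH'.
- by rewrite holds_imp IH IH'.
- by rewrite holds_all; apply: all_iff.
- by rewrite holds_ex; apply: ex2_iff.
Qed.

End BformP.

Arguments upd {X V} e i a k /.

(** * Transfer along finite environments *)

Section Transfer.
Variables (X Y : Type) (V : superstructure X) (W : superstructure Y).
Variable S : nonstandard_extension V W.

Definition env s k := nth (vempty V) s k.

(** The default on the right is the image of the default in [env], so both environments also
    correspond beyond the end of [s]. *)
Lemma transfer_sat phi s : sat (env s) phi <->
  sat (nth (S (vempty V)) (map S s)) phi.
Proof.
rewrite -!holds_bform (transfer S) !holds_bform; apply: eq_sat => k /=.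
rewrite /env; have [ks|ks] := ltnP k (size s).
  by rewrite (nth_map (vempty V)).
by rewrite !nth_default ?size_map.
Qed.

Arguments env s k /.

(** Constants: 0 = [F], 1 = [D], 2 = [C]. *)
Definition vfunction_formula :=
  FAnd (FAll 3 0 (FEx 4 1 (FEx 5 2 (FIsPair 3 4 5))))
  (FAnd (FAll 4 1 (FEx 5 2 (FPair 4 5 0)))
    (FAll 4 1 (FAll 5 2 (FAll 6 2 (FImp (FPair 4 5 0) (FImp (FPair 4 6 0)
       (FEq 5 6))))))).

Lemma star_vfunction F D C : vfunction F D C -> vfunction (S F) (S D) (S C).
Proof. by have [+ _] := transfer_sat vfunction_formula [:: F; D; C]. Qed.

Lemma star_atoms : S (vatoms V) = vatoms W.
Proof. exact: star_base. Qed.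

End Transfer.

(** * The standard objects and their transfer *)

Section Graphs.
Variables (X : Type) (V : superstructure X) (T : Type) (alpha beta : T -> V).
Variable k : nat.
Hypothesis alphak : forall t, level (@smem X V) (atom V) k (alpha t).
Hypothesis betak : forall t, level (@smem X V) (atom V) k (beta t).

Lemma graph_bounded (P : set T) :
  bounded_in k.+2 [set vpair (alpha t) (beta t) | t in P].
Proof. by move=> _ [t _ <-]; exact: level_vpair. Qed.

Lemma in_graph (P : set T) a b :
  smem (vpair a b) (vset [set vpair (alpha t) (beta t) | t in P]) <->
  exists2 t, P t & a = alpha t /\ b = beta t.
Proof.
rewrite (in_vset _ (graph_bounded (P := P))); split=> -[t Pt].
  by move=> /vpair_inj[<- <-]; exists t.
by move=> [-> ->]; exists t.
Qed.

Lemma vfunction_graph C : injective alpha -> (forall t, smem (beta t) C) ->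
  vfunction (vset [set vpair (alpha t) (beta t) | t in setT])
    (vset (range alpha)) C.
Proof.
move=> inj bC.
have inD x : smem x (vset (range alpha)) <-> range alpha x.
  by apply: (@in_vset _ _ k) => _ [t _ <-].
split; [|split].
- move=> c /(in_vset _ (graph_bounded (P := setT)))[t _ <-].
  exists (alpha t); first by apply/inD; exists t.
  by exists (beta t).
- move=> x /inD[t _ <-]; exists (beta t) => //.
  by apply/in_graph; exists t.
- move=> x _ y _ y' _ /in_graph[t _ [-> ->]] /in_graph[t' _ [/inj <- ->]] //.
Qed.

End Graphs.

Section Objects.
Variables (R : realType) (V : superstructure R).

Definition vreals (A : set R) : V := vset (atom V @` A).

Lemma atoms_bounded (A : set R) : bounded_in 0 (atom V @` A).
Proof. by move=> _ [r _ <-]; exact: level_atom. Qed.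

Lemma in_vreals (A : set R) a :
  smem a (vreals A) <-> exists2 r, A r & a = atom V r.
Proof.
rewrite (in_vset _ (@atoms_bounded A)).
by split=> [[r Ar <-]|[r Ar ->]]; exists r.
Qed.

Lemma atom_in_vreals (A : set R) r : smem (atom V r) (vreals A) <-> A r.
Proof.
rewrite in_vreals; split=> [[s As E]|Ar]; [by rewrite (atom_inj E)|by exists r].
Qed.

Lemma vreals_inj : injective vreals.
Proof.
by move=> A B E; apply/seteqP; split=> r /atom_in_vreals; 
  rewrite (E, esym E) => /atom_in_vreals.
Qed.

Lemma vatomsE : vatoms V = vreals setT. Proof. by []. Qed.

Lemma level_vreals A : level (@smem R V) (atom V) 1 (vreals A).
Proof. exact/level_vset/atoms_bounded. Qed.

Lemma vreals_is_set A : is_set (vreals A).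
Proof. exact/vset_is_set/atoms_bounded. Qed.

Lemma vemptyP : is_set (vempty V) /\ forall a, ~ smem a (vempty V).
Proof. by rewrite /vempty; case: cid. Qed.

(** The highest value is that of [-oo], the singleton of the empty set. *)
Lemma level_vext x : level (@smem R V) (atom V) 2 (vext V x).
Proof.
have l1 : level (@smem R V) (atom V) 1 (vempty V).
  by right; have [? e] := vemptyP; split=> // b /e.
case: x => [r| |]; [exact: (level_atom V 2)|exact: levelS l1|].
by apply: level_vset => _ ->.
Qed.

Lemma vext_inj : injective (@vext R V).
Proof.
have [es e0] := vemptyP.
have ne : vempty V <> vset [set vempty V].
  by move=> E; apply: (e0 (vempty V)); rewrite {2}E in_vset1.
have sr r : atom V r <> vset [set vempty V].
  by move=> E; apply: (@vset1_is_set _ V (vempty V) r); rewrite E.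
have er r : vempty V <> atom V r by exact: es.
move=> [r| |] [s| |] //= E; first (by rewrite (atom_inj E)); exfalso;
  solve [exact: (er _ (esym E))|exact: er E|exact: sr E|exact: sr (esym E)
  |exact: ne E|exact: ne (esym E)].
Qed.

Definition vexts : V := vset (range (@vext R V)).

Lemma in_vexts a : smem a vexts <-> exists x, a = vext V x.
Proof.
have b2 : bounded_in 2 (range (@vext R V)) 
  by move=> _ [x _ <-]; exact: level_vext.
by rewrite (in_vset _ b2); split=> [[x _ <-]|[x ->]]; exists x.
Qed.

Lemma vext_in x : smem (vext V x) vexts.
Proof. by apply/in_vexts; exists x. Qed.

Lemma in_vrel (r : rel (\bar R)) x y :
  smem (vpair (vext V x) (vext V y)) (vrel V r) <-> r x y.
Proof.
rewrite (@in_graph _ _ _ (fun xy => vext V xy.1) (fun xy => vext V xy.2) 2);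
  [|by move=> ?; exact: level_vext..].
split=> [[[x' y'] /= rxy [Ex Ey]]|rxy]; 
  first by rewrite (vext_inj Ex) (vext_inj Ey).
by exists (x, y).
Qed.

Section Points.
Variable n : nat.

Lemma in_vpoint (x : 'rV[R]_n) a b : smem (vpair a b) (vpoint V x) <->
  exists i : 'I_n, a = atom V i%:R /\ b = atom V (x 0 i).
Proof.
rewrite (@in_graph _ _ _ (fun i : 'I_n => atom V i%:R)
  (fun i => atom V (x 0 i)) 0);
  [|by move=> ?; exact: level_atom..].
by split=> [[i _ ?]|[i ?]]; exists i.
Qed.

Lemma vpoint_inj : injective (@vpoint R V n).
Proof.
move=> x y E; apply/rowP => i.
have : smem (vpair (atom V i%:R) (atom V (x 0 i))) (vpoint V y).
  by rewrite -E; apply/in_vpoint; exists i.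
move=> /in_vpoint[j [Ei Ex]]; have /eqP := atom_inj Ei.
by rewrite eqr_nat => /eqP/ord_inj ij; rewrite (atom_inj Ex) ij.
Qed.

Lemma level_vpoint (x : 'rV[R]_n) : level (@smem R V) (atom V) 3 (vpoint V x).
Proof. by apply/level_vset/graph_bounded => i; exact: level_atom. Qed.

Lemma in_vspace a : smem a (vspace V n) <-> exists x : 'rV[R]_n, a = vpoint V x.
Proof.
have b3 : bounded_in 3 (range (@vpoint R V n)).
  by move=> _ [x _ <-]; exact: level_vpoint.
by rewrite (in_vset _ b3); split=> [[x _ <-]|[x ->]]; exists x.
Qed.

Lemma vgraph_function (f : 'rV[R]_n -> R) :
  vfunction (vgraph V f) (vspace V n) (vatoms V).
Proof.
apply: (@vfunction_graph _ _ _ _ _ 3) => [x|x||x].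
- exact: level_vpoint.
- exact: level_atom.
- exact: vpoint_inj.
- by apply/in_vatoms; exists (f x).
Qed.

Lemma in_vgraph (f : 'rV[R]_n -> R) x b :
  smem (vpair (vpoint V x) b) (vgraph V f) <-> b = atom V (f x).
Proof.
rewrite (@in_graph _ _ _ _ _ 3); 
  [|exact: level_vpoint|move=> ?; exact: level_atom].
by split=> [[y _ [E ->]]|->]; [by rewrite (vpoint_inj E)|by exists x].
Qed.

End Points.

Lemma vabs_function : vfunction (vabs V) (vatoms V) (vatoms V).
Proof.
apply: (@vfunction_graph _ _ _ _ _ 0) => [x|x||x].
- exact: level_atom.
- exact: level_atom.
- exact: atom_inj.
- by apply/in_vatoms; exists `|x|.
Qed.

Lemma in_vabs x b : smem (vpair (atom V x) b) (vabs V) <-> b = atom V `|x|.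
Proof.
rewrite (@in_graph _ _ _ _ _ 0); [|move=> ?; exact: level_atom..].
by split=> [[y _ [E ->]]|->]; [by rewrite (atom_inj E)|by exists x].
Qed.

Definition vpowerset : V := vset (range vreals).

Lemma in_vpowerset b : smem b vpowerset <-> exists A, b = vreals A.
Proof.
have b1 : bounded_in 1 (range vreals) by move=> _ [A _ <-]; exact: level_vreals.
by rewrite (in_vset _ b1); split=> [[A _ <-]|[A ->]]; exists A.
Qed.

Lemma vsup_function : vfunction (vsup V) vpowerset vexts.
Proof.
apply: (@vfunction_graph _ _ _ _ _ 2) => [A|A||A].
- exact/levelS/level_vreals.
- exact: level_vext.
- exact: vreals_inj.
- exact: vext_in.
Qed.

Lemma in_vsup A b :
  smem (vpair (vreals A) b) (vsup V) <-> b = vext V (ereal_sup (EFin @` A)).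
Proof.
rewrite (@in_graph _ _ _ vreals _ 2); 
  [|move=> ?; exact/levelS/level_vreals|move=> ?; exact: level_vext].
by split=> [[B _ [E ->]]|->]; [by rewrite (vreals_inj E)|by exists A].
Qed.

(** The standard counterpart of [star_norm]. For [t < 0] the ball is empty and the value is [-oo],
    whence the sign conditions on radii below. *)
Definition norm_on n (f : 'rV[R]_n -> R) (t : R) : \bar R :=
  ereal_sup (EFin @` [set `|f x| | x in [set x | enorm x <= t]]).

Definition vnorm n (f : 'rV[R]_n -> R) : V :=
  vset [set vpair (atom V t) (vext V (norm_on f t)) | t in [set: R]].

Lemma vnorm_function n (f : 'rV[R]_n -> R) :
  vfunction (vnorm f) (vatoms V) vexts.
Proof.
apply: (@vfunction_graph _ _ _ _ _ 2) => [x|x||x].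
- exact: level_atom.
- exact: level_vext.
- exact: atom_inj.
- exact: vext_in.
Qed.

Lemma in_vnorm n (f : 'rV[R]_n -> R) t b :
  smem (vpair (atom V t) b) (vnorm f) <-> b = vext V (norm_on f t).
Proof.
rewrite (@in_graph _ _ _ _ _ 2); 
  [|move=> ?; exact: level_atom|move=> ?; exact: level_vext].
by split=> [[y _ [E ->]]|->]; [by rewrite (atom_inj E)|by exists t].
Qed.

End Objects.
Arguments vexts {R} V.
Arguments vpowerset {R} V.
Arguments vreals {R} V A.
Arguments vnorm {R} V {n} f.

(** * Nonstandard norms in terms of real radii *)

Section Star.
Variables (R : realType) (Y : Type).
Variables (V : superstructure R) (W : superstructure Y).
Variable S : nonstandard_extension V W.
Variable d : Y.

(* Constants: 0 = R, 1 = extended reals, 2 = P(R), 3 = R^n, 4 = [enorm], 5 = <=,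
   6 = f, 7 = absolute value, 8 = sup, 9 = [vnorm f].  Bound variables: 10 = t,
   11 = y, 12 = b, 13 = z, 14 = x, 15 = the norm of x, 16 = f x.  If y is the
   norm of f on the ball of radius t, then y = sup b for the set b of the values
   z of |f| on this ball. *)
Definition norm_formula :=
  let members := FAll 13 12 (FEx 14 3 (FEx 15 0 (FEx 16 0 (FAnd (FPair 14 15 4)
    (FAnd (FPair 15 10 5) (FAnd (FPair 14 16 6) (FPair 16 13 7))))))) in
  let contains := FAll 14 3 (FAll 15 0 (FAll 16 0 (FAll 13 0
    (FImp (FPair 14 15 4) (FImp (FPair 15 10 5) (FImp (FPair 14 16 6)
    (FImp (FPair 16 13 7) (FMem 13 12)))))))) in
  FAll 10 0 (FAll 11 1 (FImp (FPair 10 11 9) (FEx 12 2 (FAnd (FPair 12 11 8)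
    (FAnd (FNot (FMem 12 0)) (FAnd members contains)))))).

(** Transfer of [norm_formula] yields an internal set [b] whose *sup is the right-hand side; its two
    inclusions identify [b] with the set of values collected in [star_norm]. *)
Lemma star_normE n (f : 'rV[R]_n -> R) :
  star_norm S d f = vapp (S (vnorm V f)) (atom W d).
Proof.
pose s := [:: vatoms V; vexts V; vpowerset V; vspace V n; vgraph V (@enorm R n);
  vrel V <=%O; vgraph V f; vabs V; vsup V; vnorm V f].
have /(transfer_sat S)/= H : sat (env s) norm_formula.
  move=> /= _ /in_vatoms[t ->] y _ /in_vnorm ->.
  exists (vreals V [set `|f x| | x in [set x | enorm x <= t]]).
    by apply/in_vpowerset; eexists.
  split; first exact/in_vsup.
  split; first by move=> /in_vatoms[x /vreals_is_set].
  split=> [_ /in_vreals[_ [x /= xt <-] ->]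
    |_ /in_vspace[x ->] e _ w _ z _ /in_vgraph->].
    exists (vpoint V x); first by apply/in_vspace; exists x.
    exists (atom V (enorm x)); first by apply/in_vatoms; eexists.
    exists (atom V (f x)); first by apply/in_vatoms; eexists.
    split; first exact/in_vgraph.
    split; first by apply/(@in_vrel _ _ _ (enorm x)%:E t%:E); rewrite lee_fin.
    by split; [exact/in_vgraph|exact/in_vabs].
  move=> /(@in_vrel _ _ _ (enorm x)%:E t%:E); rewrite lee_fin => xt.
  by move=> /in_vgraph-> /in_vabs->; apply/atom_in_vreals; exists x.
have dR : smem (atom W d) (S (vatoms V)).
  by rewrite star_atoms; apply/in_vatoms; exists d.
have [yE dy] := vappP (star_vfunction S (vnorm_function V f)) dR.
have SE := star_vfunction S (vgraph_function V (@enorm R n)).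
have Sf := star_vfunction S (vgraph_function V f).
have SA := star_vfunction S (vabs_function V).
have SS := star_vfunction S (vsup_function V).
have [b bP [bsup [bR [b1 b2]]]] := H _ dR _ yE dy.
rewrite /star_norm -(vapp_eq SS bsup); congr (vapp _ _).
have inb xi : star_ball S d n xi -> 
  smem (vapp (S (vabs V)) (vapp (S (vgraph V f)) xi)) b.
  move=> [xiS xid].
  have [eR xie] := vappP SE xiS.
  have [wR xiw] := vappP Sf xiS.
  have [zR wz] := vappP SA wR.
  exact: (b2 xi xiS _ eR _ wR _ zR xie xid xiw wz).
apply: (@vset_eq _ _ 0).
- move=> _ [xi xid <-].
  have [wR _] := vappP Sf (proj1 xid).
  have [+ _] := vappP SA wR.
  by rewrite star_atoms => /in_vatoms[z ->]; exists z.
(* The clause that [b] is not in [R] transfers to [b] not being an urelement, as extensionality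
   requires. *)
- by move=> z bz; apply: bR; rewrite bz star_atoms; apply/in_vatoms; exists z.
- move=> z; split=> [/b1[xi xiS [e eR [w wR [xie [ed [xiw wz]]]]]]
    |[xi /inb + <-]//].
  exists xi; last by rewrite (vapp_eq Sf xiw) (vapp_eq SA wz).
  by split=> //; rewrite (vapp_eq SE xie).
Qed.

(* [A] holds for almost all radii [t] with respect to the ultrafilter
   determined by [d]. *)
Definition at_radius (A : set R) : Prop := smem (atom W d) (S (vreals V A)).

(** Transfer of the inclusion covers both upward closure and closure under intersection. *)
Lemma at_radius2 (A B C : set R) : (A `&` B `<=` C) ->
  at_radius A -> at_radius B -> at_radius C.
Proof.
move=> ABC dA dB.
have [+ _] := transfer_sat S (FAll 3 0 (FImp (FMem 3 1) (FMem 3 2)))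
  [:: vreals V A; vreals V B; vreals V C].
apply => //= _ /in_vreals[t At ->] /atom_in_vreals Bt.
exact/atom_in_vreals/ABC.
Qed.

(* Constants: 0 = R, 1 = extended reals, 2 = [vnorm f], 3 = [vnorm g], 4 = <,
   5 = the set of radii at which f has a smaller norm than g. *)
Definition lt_formula :=
  FAll 10 0 (FAll 11 1 (FAll 12 1 (FImp (FPair 10 11 2) (FImp (FPair 10 12 3)
    (FAnd (FImp (FPair 11 12 4) (FMem 10 5))
          (FImp (FMem 10 5) (FPair 11 12 4))))))).

(** Membership in [T] is equivalent to the inequality at every real radius; the equivalence is
    transferred and read at [d]. *)
Lemma star_norm_lt n (f g : 'rV[R]_n -> R) :
  star_lt S (star_norm S d f) (star_norm S d g) <->
  at_radius [set t | (norm_on f t < norm_on g t)%E].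
Proof.
rewrite !star_normE.
set T := [set t | _].
have dR : smem (atom W d) (S (vatoms V)).
  by rewrite star_atoms; apply/in_vatoms; exists d.
have [yE dy] := vappP (star_vfunction S (vnorm_function V f)) dR.
have [zE dz] := vappP (star_vfunction S (vnorm_function V g)) dR.
have /(transfer_sat S)/= H : sat (env [:: vatoms V; vexts V; vnorm V f;
    vnorm V g; vrel V <%O; vreals V T]) lt_formula.
  move=> /= _ /in_vatoms[t ->] y _ z _ /in_vnorm-> /in_vnorm->.
  by rewrite in_vrel atom_in_vreals.
exact: H _ dR _ yE _ zE dy dz.
Qed.

Lemma star_norm0 n : at_radius [set t | 0 <= t] ->
  star_norm S d (fun _ : 'rV[R]_n => 0) = S (atom V 0).
Proof.
move=> d0; rewrite star_normE.
apply: (vapp_eq (star_vfunction S (vnorm_function V _))).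
have [+ _] := transfer_sat S (FAll 3 0 (FPair 3 1 2))
  [:: vreals V [set t | 0 <= t]; atom V 0; vnorm V (fun _ : 'rV[R]_n => 0)].
apply=> //= _ /in_vreals[t /= t0 ->]; apply/in_vnorm.
rewrite -[LHS]/(vext V 0%:E) /norm_on; congr vext.
suff -> : [set `|(0 : R)| | _ in [set x : 'rV[R]_n | enorm x <= t]] = [set 0].
  by rewrite image_set1 ereal_sup1.
apply/seteqP; split=> [_ [x _ <-] /=|_ -> /=]; first exact: normr0.
exists 0; last exact: normr0.
rewrite /= /enorm big1 ?sqrtr0// => i _.
by rewrite mxE expr0n.
Qed.

(** Infinitesimality enters through this lemma: identities of germs, valid on some small ball, may
    be used at almost all radii. *)
Lemma at_radius_small (tau : R) : positive_infinitesimal S d -> 0 < tau ->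
  at_radius [set t | 0 < t < tau].
Proof.
move=> [d0 dr] tau0.
have dR : smem (atom W d) (S (vatoms V)).
  by rewrite star_atoms; apply/in_vatoms; exists d.
have [+ _] := transfer_sat S (FAll 6 0 (FImp (FPair 1 6 3)
    (FImp (FPair 6 2 3) (FMem 6 4))))
  [:: vatoms V; atom V 0; atom V tau; vrel V <%O;
      vreals V [set t | 0 < t < tau]].
apply=> //=; last exact: dr.
move=> _ /in_vatoms[t ->] /(@in_vrel _ _ _ 0%:E t%:E) +
  /(@in_vrel _ _ _ t%:E tau%:E).
by rewrite !lte_fin => t0 ttau; apply/atom_in_vreals => /=; rewrite t0.
Qed.

End Star.

(** * The modulus of a strict inequality of norms *)

Section WeightedSum.
Variables (R : realType) (w : nat -> R).
Hypothesis w01 : forall m, 0 < w m <= 1.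

Let C m : R := w m / (2 ^ m.+1)%:R.

(** As [w m <= 1], the series is dominated by a geometric one of sum 1, so [fine] loses nothing. *)
Definition weight (Q : pred nat) : R := fine (\sum_(m <oo | Q m) (C m)%:E).

Let C_gt0 m : 0 < C m.
Proof. by have /andP[? _] := w01 m; rewrite divr_gt0// ltr0n expn_gt0. Qed.

Let C_ge0 m : (0 <= (C m)%:E)%E. Proof. by rewrite lee_fin ltW. Qed.

Let weightE Q : (weight Q)%:E = (\sum_(m <oo | Q m) (C m)%:E)%E.
Proof.
rewrite fineK// ge0_fin_numE ?nneseries_ge0//.
apply: (@le_lt_trans _ _ 1%:E); last by rewrite ltry.
apply: le_trans (epsilon_trick0 Q (@ler01 R)).
apply: lee_nneseries => // m _; 
rewrite lee_fin /C ler_pM2r ?invr_gt0 ?ltr0n ?expn_gt0//.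
by have /andP[] := w01 m.
Qed.

Lemma weight0 Q : (forall m, ~~ Q m) -> weight Q = 0.
Proof.
move=> Q0; rewrite /weight eseries0// => m _ Qm.
by have := Q0 m; rewrite Qm.
Qed.

Lemma weight_ge0 Q : 0 <= weight Q.
Proof. by rewrite -lee_fin weightE nneseries_ge0. Qed.

Lemma le_weight (Q Q' : pred nat) :
  (forall m, Q m -> Q' m) -> weight Q <= weight Q'.
Proof. by move=> QQ'; rewrite -lee_fin !weightE subset_lee_nneseries. Qed.

Lemma lt_weight (Q Q' : pred nat) m : (forall m, Q m -> Q' m) ->
  Q' m -> ~~ Q m -> weight Q < weight Q'.
Proof.
move=> QQ' Q'm Qm; apply: (@lt_le_trans _ _ (C m + weight Q)).
  by rewrite ltrDr.
rewrite -lee_fin EFinD !weightE [leRHS](nneseriesD1 _ Q'm)//.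
apply: leeD2l; apply: subset_lee_nneseries => // k Qk.
by rewrite QQ'//=; apply: contraNneq Qm => <-.
Qed.

(** The indices of [Q'] outside [Q] contribute at most the sum of the [u / 2 ^ m.+1], that is [u].
    Contraposed: an excess of more than [u] exhibits an index with [u < w m]. *)
Lemma weight_gap (Q Q' : pred nat) u : 0 <= u ->
  (forall m, Q' m -> ~~ Q m -> w m <= u) -> weight Q' <= weight Q + u.
Proof.
move=> u0 wu; rewrite -lee_fin EFinD !weightE.
apply: (@le_trans _ _ (\sum_(m <oo | Q m) (C m)%:E +
    \sum_(m <oo) (u / (2 ^ m.+1)%:R)%:E)%E); last first.
  exact/leeD2l/epsilon_trick0.
rewrite eseries_mkcond [X in (_ <= X + _)%E]eseries_mkcond.
have u2 m : 0 <= u / (2 ^ m.+1)%:R by rewrite divr_ge0.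
rewrite -nneseriesD; [|by move=> m _ _; case: ifP|
  by move=> m _ _; rewrite lee_fin].
apply: lee_nneseries => [m _ _|m _]; first by case: ifP.
case: ifPn => Q'm; case: ifPn => Qm.
- by rewrite leeDl// lee_fin.
- by rewrite add0e lee_fin ler_pM2r ?invr_gt0 ?ltr0n ?expn_gt0// wu.
- by rewrite adde_ge0// lee_fin.
- by rewrite add0e lee_fin.
Qed.

End WeightedSum.

(** * Euclidean balls and norms over them *)

Section NormOn.
Variables (R : realType) (n : nat).
Implicit Types (f : 'rV[R]_n -> R) (x : 'rV[R]_n).

Lemma enorm_ge0 x : 0 <= enorm x.
Proof. exact: sqrtr_ge0. Qed.

Lemma enorm0 : enorm (0 : 'rV[R]_n) = 0.
Proof. by rewrite /enorm big1 ?sqrtr0// => i _; rewrite mxE expr0n. Qed.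

Lemma le_coord_enorm x i : `|x 0 i| <= enorm x.
Proof.
rewrite -sqrtr_sqr ler_wsqrtr// (bigD1 i)//= lerDl sumr_ge0// => j _.
exact: sqr_ge0.
Qed.

Lemma enorm_le0 x : enorm x <= 0 -> x = 0.
Proof.
move=> x0; apply/rowP => i; rewrite mxE; apply/eqP; rewrite -normr_le0.
exact: le_trans (le_coord_enorm x i) x0.
Qed.

(** The sup norm is attained; [x != 0] ensures that there is a coordinate at all. *)
Lemma norm_row_coord x : x != 0 -> exists j, `|x| = `|x 0 j|.
Proof.
rewrite -normr_eq0 => x0; have [[i j] /= xE] := mx_norm_neq0 x0.
by exists j; rewrite -[Num.norm x]/(mx_norm x) xE ord1.
Qed.

Lemma le_coord_norm x i : `|x 0 i| <= `|x|.
Proof.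
rewrite -[leRHS]/(mx_norm x) mx_normrE.
exact: (le_bigmax _ (fun ij : 'I_1 * 'I_n => `|x ij.1 ij.2|) (0, i)).
Qed.

Lemma le_norm_enorm x : `|x| <= enorm x.
Proof.
have [->|x0] := eqVneq x 0; first by rewrite normr0 enorm_ge0.
by have [j ->] := norm_row_coord x0; exact: le_coord_enorm.
Qed.

Lemma le_norm_on f x t : enorm x <= t -> (`|f x|%:E <= norm_on f t)%E.
Proof.
by move=> xt; apply: ereal_sup_ubound; exists `|f x| => //; exists x.
Qed.

Lemma norm_on_le f t M : (forall x, enorm x <= t -> (`|f x|%:E <= M)%E) ->
  (norm_on f t <= M)%E.
Proof. by move=> fM; apply: ge_ereal_sup => _ [_ [x xt <-] <-]; exact: fM. Qed.

Lemma le_norm_on_radius f s t : s <= t -> (norm_on f s <= norm_on f t)%E.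
Proof.
move=> st; apply: norm_on_le => x xs; apply: le_norm_on (le_trans xs st).
Qed.

Lemma norm_on_ge0 f t : 0 <= t -> (0 <= norm_on f t)%E.
Proof.
move=> t0; apply: (@le_trans _ _ `|f 0|%:E); first by rewrite lee_fin.
by apply: le_norm_on; rewrite enorm0.
Qed.

Lemma norm_onN f t : norm_on (fun x => - f x) t = norm_on f t.
Proof.
rewrite /norm_on; congr ereal_sup; congr image.
by apply: eq_imagel => x _; rewrite normrN.
Qed.

(** The gap [e] may depend on [x], so a uniform bound [M] must be found strictly below the norm of
    [g0]. *)
Lemma lt_norm_on f (g0 f1 : 'rV[R]_n -> R) (t : R) : 0 <= t ->
  (norm_on f t < norm_on g0 t)%E ->
  (forall x, enorm x <= t -> exists2 e, 0 < e &
     `|f1 x| <= `|f x| + Num.min (e / 2) 1 /\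
     ((`|f x| + e)%:E <= norm_on g0 t)%E) ->
  (norm_on f1 t < norm_on g0 t)%E.
Proof.
move=> t0 fg H.
have := norm_on_ge0 f t0; have := @le_norm_on f ^~ t; move: fg.
case: (norm_on f t) => [s| |] //= fg fs _; last by rewrite ltNge leey in fg.
(* If [r] is finite, [|f x| + e / 2] is the mean of [|f x| <= s] and [|f x| + e <= r]; if it is
   infinite, the cap 1 gives the bound [s + 1]. *)
pose M : R := if norm_on g0 t is r%:E then (s + r) / 2 else s + 1.
apply: (@le_lt_trans _ _ M%:E).
  apply: norm_on_le => x xt; have [e e0 [f1x fx]] := H x xt.
  have := fs x xt; rewrite !lee_fin /M => fxs.
  have m1 : Num.min (e / 2) 1 <= e / 2 by rewrite ge_min lexx.
  have m2 : Num.min (e / 2) 1 <= 1 by rewrite ge_min lexx orbT.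
  by move: fx; case: (norm_on g0 t) => [r| |]; rewrite ?lee_fin; lra.
move: fg; rewrite /M; case: (norm_on g0 t) => [r| |] //;
  by rewrite ?lte_fin ?ltry//; lra.
Qed.

End NormOn.

(** * Construction of the functions [a] and [b] *)

Section Modulus.
Variables (R : realType) (n : nat) (g g0 : 'rV[R]_n -> R).
Hypotheses (g00 : g 0 = 0) (g000 : g0 0 = 0).
Variable rho : R -> R.
Hypothesis rho_gt0 : forall e, 0 < e -> 0 < rho e.

Let s := norm_on g.
Let r := norm_on g0.

(** An enumeration of the rationals. The default 0 is harmless, since [sep m] forces [0 < q m]. *)
Let q (m : nat) : R :=
  if (unpickle m : option rat) is Some x then ratr x else 0.

Let q_dense (x y : R) : x < y -> exists m, x < q m < y.
Proof.
move=> xy; have [z] := rat_in_itvoo xy; rewrite in_itv /= => zxy.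
by exists (pickle z); rewrite /q pickleK.
Qed.

Let q_dense_ereal t : 0 < t -> (s t < r t)%E ->
  exists m, (s t < (q m)%:E)%E /\ ((q m)%:E < r t)%E.
Proof.
move=> t0; have := norm_on_ge0 g (ltW t0); rewrite -/(s t).
case: (s t) => [x| |] //= _; case: (r t) => [y| |] //=.
  by rewrite lte_fin => /q_dense[m /andP[? ?]]; exists m; rewrite !lte_fin.
move=> _; have [|m /andP[? ?]] := @q_dense x (x + 1); first by rewrite ltrDl.
by exists m; rewrite lte_fin ltry.
Qed.

Let sep m := exists t, [/\ 0 < t, (s t < (q m)%:E)%E & ((q m)%:E < r t)%E].

Let sep_gt0 m : sep m -> 0 < q m.
Proof.
move=> [t [t0 st _]]; rewrite -lte_fin; apply: le_lt_trans st.
exact: norm_on_ge0 (ltW t0).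
Qed.

(* By monotonicity in the radius, the distances from [q m] to [s t0] and [r t0]
   at a single radius [t0] control the gap at every other one. *)
Let gap_ex m : exists e, 0 < e /\ forall t x, sep m -> enorm x <= t ->
  `|g x| < q m -> ((q m)%:E < r t)%E -> ((`|g x| + e)%:E <= r t)%E.
Proof.
have [[t0 [t0_gt0 st0 rt0]]|nsep] := pselect (sep m); last first.
  by exists 1; split=> // t x /nsep.
have [sig [sig1 sig2]] : exists sig, (s t0 <= sig%:E)%E /\ sig < q m.
  have := norm_on_ge0 g (ltW t0_gt0); rewrite -/(s t0); move: st0.
  by case: (s t0) => [x| |] // xq _; exists x; rewrite -lte_fin.
have [tau [tau1 tau2]] : exists tau, (tau%:E <= r t0)%E /\ q m < tau.
  move: rt0; case: (r t0) => [x| |] // xq; first by exists x; rewrite -lte_fin.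
  by exists (q m + 1); rewrite leey ltrDl.
exists (Num.min (q m - sig) (tau - q m)); split.
  by rewrite lt_min !subr_gt0 sig2.
(* For [t0 <= t] the gap is [tau - q m], because [tau] stays below [r t]; for [t < t0] it is
   [q m - sig], because [|g x|] stays below [sig]. *)
move=> t x _ xt gq qr; have [t0t|tt0] := leP t0 t.
  apply: le_trans (le_trans tau1 (le_norm_on_radius g0 t0t)).
  have : Num.min (q m - sig) (tau - q m) <= tau - q m.
    by rewrite ge_min lexx orbT.
  by rewrite lee_fin; lra.
apply: le_trans (ltW qr).
have : (`|g x|%:E <= sig%:E)%E.
  apply: le_trans sig1; apply: le_trans (le_norm_on g xt) _.
  exact: le_norm_on_radius (ltW tt0).
have : Num.min (q m - sig) (tau - q m) <= q m - sig by rewrite ge_min lexx.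
by rewrite !lee_fin; lra.
Qed.

Lemma modulus : exists a b : 'rV[R]_n -> R, [/\ a 0 = 0, b 0 = 0,
  forall t, 0 < t -> (norm_on g t < norm_on g0 t)%E ->
    (norm_on a t < norm_on b t)%E &
  forall t x u, 0 < t -> enorm x <= t -> 0 <= u ->
    ((u + a x)%:E < norm_on b t)%E ->
    exists2 e, 0 < e & u < rho e /\ ((`|g x| + e)%:E <= norm_on g0 t)%E].
Proof.
have [e eP] := choice gap_ex.
(* The cap 1 ensures summability; [rho (e m)] is the displacement that the gap [e m] tolerates. *)
pose w m := Num.min 1 (rho (e m)).
have w01 m : 0 < w m <= 1.
  by have [em _] := eP m; rewrite lt_min ltr01 rho_gt0//= ge_min lexx.
(* An index in [sbelow (r t)] but not in [below |g x|] satisfies [|g x| < q m < r t], the situation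
   of [gap_ex]. *)
pose below v m := `[< sep m >] && ((q m)%:E <= v)%E.
pose sbelow v m := `[< sep m >] && ((q m)%:E < v)%E.
pose a x := weight w (below `|g x|%:E).
pose b (x : 'rV[R]_n) := weight w (sbelow (r (enorm x))).
have a_le t x : enorm x <= t -> a x <= weight w (below (s t)).
  move=> xt; apply: le_weight => // m /andP[sm qm]; rewrite /below sm/=.
  exact: le_trans qm (le_norm_on _ xt).
have b_le t : (norm_on b t <= (weight w (sbelow (r t)))%:E)%E.
  apply: norm_on_le => x xt; rewrite lee_fin ger0_norm ?weight_ge0//.
  apply: le_weight => // m /andP[sm qm]; rewrite /sbelow sm/=.
  exact: lt_le_trans qm (le_norm_on_radius _ xt).
exists a, b; split.
- apply: weight0 => m; rewrite /below g00 normr0 lee_fin negb_and -ltNge.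
  by rewrite -implybE; apply/implyP => /asboolP/sep_gt0.
- apply: weight0 => m; rewrite /sbelow enorm0 negb_and -leNgt -implybE.
  apply/implyP => /asboolP/sep_gt0 qm; apply: (@le_trans _ _ 0%:E);
    last by rewrite lee_fin ltW.
  by apply: norm_on_le => x /enorm_le0 ->; rewrite g000 normr0.
- move=> t t0 st.
  have [m [smq qmr]] := q_dense_ereal t0 st.
  have sepm : sep m by exists t.
  (* At a point of the sphere, [b] equals the bound in [b_le]. For [n = 0] there is no such point,
     but then [g0] vanishes identically, against [st]. *)
  have [x xt] : exists x : 'rV[R]_n, enorm x = t.
    case: (posnP n) => [n0|n0].
      move: st; suff : (r t <= s t)%E by rewrite leNgt => /negP.
      apply: norm_on_le => x _; suff -> : x = 0.
        by rewrite g000 normr0; exact: norm_on_ge0 (ltW t0).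
      by apply/rowP => i; have := ltn_ord i; rewrite [X in (_ < X)%N]n0.
    pose i0 := Ordinal n0.
    exists (\row_j if j == i0 then t else 0).
    rewrite /enorm (bigD1 i0)//= big1 => [|j /negPf ji].
      by rewrite addr0 mxE eqxx sqrtr_sqr ger0_norm// ltW.
    by rewrite mxE ji expr0n.
  apply: (@le_lt_trans _ _ (weight w (below (s t)))%:E).
    by apply: norm_on_le => y yt; rewrite lee_fin ger0_norm ?weight_ge0// a_le.
  apply: (@lt_le_trans _ _ `|b x|%:E); last by apply: le_norm_on; rewrite xt.
  rewrite ger0_norm ?weight_ge0// lte_fin /b xt.
  apply: (@lt_weight _ _ w01 _ _ m).
  + by move=> k /andP[sk qk]; rewrite /sbelow sk /=; exact: le_lt_trans qk st.
  + by rewrite /sbelow qmr andbT; apply/asboolP.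
  + by rewrite /below negb_and -ltNge smq orbT.
- move=> t x u t0 xt u0 /lt_le_trans/(_ (b_le t)); rewrite lte_fin => ub.
  (* Without such an index, [weight_gap] would contradict [ub]. *)
  have [m [sm qm gm um]] : exists m,
      [/\ sep m, ((q m)%:E < r t)%E, `|g x| < q m & u < w m].
    apply: contrapT => none.
    have : weight w (sbelow (r t)) <= a x + u.
      apply: weight_gap => // m /andP[/asboolP sm qm].
      rewrite /below negb_and (asboolT sm)/= -ltNge lte_fin => gm.
      by rewrite leNgt; apply/negP => um; apply: none; exists m.
    by rewrite addrC leNgt ub.
  have [em egap] := eP m; exists (e m) => //; split; last exact: egap.
  by apply: lt_le_trans um _; rewrite ge_min lexx orbT.
Qed.

End Modulus.

(** * Continuity of left composition *)

(** Lets finitely many conditions on the radius be combined by the general filter lemmas. *)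
Global Instance at_radius_filter (R : realType) (Y : Type) 
  (V : superstructure R) (W : superstructure Y) (S : nonstandard_extension V W)
  (d : Y) : Filter (at_radius S d).
Proof.
split.
- by rewrite /at_radius -vatomsE star_atoms; apply/in_vatoms; exists d.
- by move=> A B; exact: at_radius2.
- by move=> A B AB dA; apply: (at_radius2 _ dA dA) => t [/AB].
Qed.

Lemma near0_enorm (R : realType) n (P : set 'rV[R]_n) :
  (\forall x \near (0 : 'rV[R]_n), P x) ->
  exists2 tau, 0 < tau & forall x, enorm x < tau -> P x.
Proof.
move=> /nbhs_ballP[e /= e0 eP]; exists e => // x xe; apply: eP.
rewrite -ball_normE /ball_ /= sub0r normrN.
exact: le_lt_trans (le_norm_enorm x) xe.
Qed.

(** Only [y] has to lie in [K]: continuity in the ambient space at the points of [K] also controls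
    [z] outside. This is needed because the perturbed map may leave the ball. *)
Lemma compact_uniform_continuity (R : realType) (U V : normedModType R)
    (K : set U) (h : U -> V) : compact K ->
  (forall y, K y -> {for y, continuous h}) ->
  forall e, 0 < e -> exists2 dlt, 0 < dlt &
    forall y z, K y -> `|y - z| < dlt -> `|h y - h z| <= e.
Proof.
move=> cK ch e e0.
have := (compact_near_coveringP K).1 cK R (0^'+)
  (fun dlt y => forall z, `|y - z| < dlt -> `|h y - h z| <= e) _.
case.
  move=> y Ky.
  have /cvgrPdist_lt/(_ (e / 2)) := ch y Ky.
  rewrite divr_gt0// => /(_ isT)/nbhs_ballP[eta /= eta0 etaP].
  (* With halved radii both [y'] and [z] stay within [eta] of [y]. *)
  exists (ball y (eta / 2), [set dlt | dlt < eta / 2]).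
    split=> /=; first by apply: nbhsx_ballx; rewrite divr_gt0.
    by apply: nbhs_right_lt; rewrite divr_gt0.
  move=> [y' dlt] [/= yy' dlteta] z y'z.
  move: yy'; rewrite -ball_normE /ball_ /= => yy'.
  have h1 : `|h y - h y'| < e / 2.
    by apply: etaP; rewrite -ball_normE /ball_ /=; lra.
  have h2 : `|h y - h z| < e / 2.
    apply: etaP; rewrite -ball_normE /ball_ /=.
    by have := ler_distD y' y z; lra.
  by have := ler_distD (h y) (h y') (h z); rewrite (distrC (h y') (h y)); lra.
move=> dlt /= dlt0 H; exists (dlt / 2); first by rewrite divr_gt0.
by move=> y z Ky yz; apply: (H (dlt / 2)) => //=;
  rewrite ?divr_gt0// sub0r normrN gtr0_norm ?divr_gt0//; lra.
Qed.

(** The reason for translating both by [a] and by [- a]: whatever the sign of [y' - y], one of the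
    remainders [v], [w] absorbs the displacement together with [a]. *)
Lemma norm_shift (R : realType) (y y' a v w : R) :
  y' = y + a + v -> y' = y - a + w ->
  (y' <= y -> `|y - y'| + a <= `|v|) /\ (y <= y' -> `|y - y'| + a <= `|w|).
Proof.
move=> yv yw; split=> yy.
  rewrite ger0_norm ?subr_ge0//; have := ler_norm (- v); rewrite normrN; lra.
rewrite distrC ger0_norm ?subr_ge0//; have := ler_norm w; lra.
Qed.

(** * Neighbourhoods in terms of representatives *)

Section Core.
Variables (R : realType) (Y : Type).
Variables (V : superstructure R) (W : superstructure Y).
Variables (S : nonstandard_extension V W) (d : Y).
Hypothesis d_inf : positive_infinitesimal S d.

Variables (n p : nat) (h : pmap R p 'rV[R]_p) (f : pmap R n 'rV[R]_p).
Hypotheses (ch : continuous_pmap h) (cf : continuous_pmap f).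

Lemma lcomp_nbhd (i : 'I_p) (A : set (germ R n R)) : tau_subbase S d n A ->
  A (germ_coord (germ_of (pcomp h f)) i) ->
  exists B : 'I_p -> set (germ R n R) * set (germ R n R),
  (forall j, [/\ tau_subbase S d n (B j).1, tau_subbase S d n (B j).2,
     (B j).1 (germ_coord (germ_of f) j) &
     (B j).2 (germ_coord (germ_of f) j)]) /\
  forall f' : pmap R n 'rV[R]_p,
    (forall j, (B j).1 (germ_coord (germ_of f') j) /\
               (B j).2 (germ_coord (germ_of f') j)) ->
    A (germ_coord (germ_of (pcomp h f')) i).
Proof.
move=> [k [r [[g0 _ <-] r0 ->]]] [_ [g gr <-]].
have [kap -> {k}] : exists kap, k = germ_of kap.
  by exists (repr k); rewrite germ_of_repr.
rewrite germ_coordE germ_addE => /germ_ofP/= near_g.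
have [r1 r10 hr1] : exists2 r1, 0 < r1 & forall y, `|y| <= r1 ->
    {for y, continuous (val h)}.
  have /nbhs_ballP[r1 /= r10 hr1] := ch.
  exists (r1 / 2); first by rewrite divr_gt0.
  move=> y yr; apply: hr1; rewrite -ball_normE /ball_ /= sub0r normrN; lra.
have cK : compact [set y : 'rV[R]_p | `|y| <= r1].
  apply: bounded_closed_compact.
    exists r1; split; first exact: num_real.
    by move=> M r1M y /= /le_trans; apply; exact: ltW.
  rewrite (_ : [set _ | _] =
    (fun y : 'rV[R]_p => `|y|) @^-1` [set x | x <= r1])//.
  by apply: closed_comp => [y _|]; [exact: norm_continuous|exact: closed_le].
(* The tolerance is that of [lt_norm_on]. The premise [0 < e] stands under the quantifier so that
   [choice] gives a total function. *)
have /choice[rho rhoP] e : exists dlt, 0 < e -> 0 < dlt /\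
    forall y z, `|y| <= r1 -> `|y - z| < dlt ->
      `|val h y - val h z| <= Num.min (e / 2) 1.
  have [e0|] := ltP 0 e; last by move=> e0; exists 0.
  have [|dlt dlt0 dltP] :=
    compact_uniform_continuity cK hr1 (e := Num.min (e / 2) 1).
    by rewrite lt_min ltr01 divr_gt0.
  by exists dlt.
have [a [b [a0 b0 ab abu]]] :=
  modulus (pmap0 g) (pmap0 g0) (fun e e0 => (rhoP e e0).1).
have Na0 : - a 0 = 0 by rewrite a0 oppr0.
pose a1 : pmap R n R := Pmap a0.
pose a2 : pmap R n R := Pmap (f := fun x => - a x) Na0.
pose b1 : pmap R n R := Pmap b0.
have /star_norm_lt gr' := gr.
have small := at_radius_small d_inf.
have ab' : star_lt S (star_norm S d a) (star_norm S d b).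
  apply/star_norm_lt; move: (small _ ltr01) gr'.
  apply: filterS2 => t /andP[t0 _].
  exact: ab.
have Nab' : star_lt S (star_norm S d (fun x => - a x)) (star_norm S d b).
  move/star_norm_lt: ab' => ab'; apply/star_norm_lt.
  by apply: filterS ab' => t /=; rewrite norm_onN.
(* Required for the norm of [b] to be the radius of a subbasic set. *)
have b_gt0 : star_lt S (S (atom V 0)) (star_norm S d b).
  rewrite -(@star_norm0 _ _ _ _ S d n); last first.
    by apply: filterS (small _ ltr01) => t /andP[/ltW].
  move/star_norm_lt: ab' => ab'; apply/star_norm_lt.
  apply: filterS2 (small _ ltr01) ab' => t /andP[t0 _]; apply: le_lt_trans.
  apply: norm_on_le => x _; rewrite normr0; exact: norm_on_ge0 (ltW t0).
pose U : set (germ R n R) := germ_nbhd S d (star_norm S d b).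
exists (fun j => ([set germ_add (germ_of (padd (pcoord f j) a1)) g | g in U],
                  [set germ_add (germ_of (padd (pcoord f j) a2)) g | g in U])).
split=> [j|f' f'P].
  split.
  - exists (germ_of (padd (pcoord f j) a1)), (star_norm S d b).
    by split=> //; exists b1.
  - exists (germ_of (padd (pcoord f j) a2)), (star_norm S d b).
    by split=> //; exists b1.
  (* Each coordinate is [(f_j + a) - a], and [- a] has smaller norm than [b]; the other translate is
     symmetric. *)
  - exists (germ_of a2); first (exists a2; [exact: Nab'|reflexivity]).
    rewrite germ_coordE germ_addE; congr germ_of; apply: val_inj.
    apply: funext => x /=.
    by rewrite addrK.
  - exists (germ_of a1); first (exists a1; [exact: ab'|reflexivity]).
    rewrite germ_coordE germ_addE; congr germ_of; apply: val_inj.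
    apply: funext => x /=.
    by rewrite subrK.
have /choice[v vP] j : exists v : pmap R n R,
    star_lt S (star_norm S d (val v)) (star_norm S d b) /\
    \forall x \near (0 : 'rV[R]_n), val f' x 0 j = val f x 0 j + a x + val v x.
  have [[_ [v vb <-] +] _] := f'P j.
  rewrite germ_coordE germ_addE => /germ_ofP E.
  by exists v; split=> //; apply: filterS E => x /= ->.
have /choice[w wP] j : exists w : pmap R n R,
    star_lt S (star_norm S d (val w)) (star_norm S d b) /\
    \forall x \near (0 : 'rV[R]_n), val f' x 0 j = val f x 0 j - a x + val w x.
  have [_ [_ [w wb <-] +]] := f'P j.
  rewrite germ_coordE germ_addE => /germ_ofP E.
  by exists w; split=> //; apply: filterS E => x /= ->.
(* [g1] is what coordinate [i] of the new composite adds to the centre [kap]; its norm has to be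
   below that of [g0]. *)
have g1_0 : val h (val f' 0) 0 i - val kap 0 = 0.
  by rewrite !pmap0 mxE subrr.
pose g1 : pmap R n R :=
  Pmap (f := fun x => val h (val f' x) 0 i - val kap x) g1_0.
exists (germ_of g1); last first.
  rewrite germ_coordE germ_addE; congr germ_of; apply: val_inj.
    apply: funext => x /=.
  by rewrite addrC subrK.
exists g1; [apply/star_norm_lt|reflexivity].
have near_v : \forall x \near (0 : 'rV[R]_n), forall j,
    val f' x 0 j = val f x 0 j + a x + val (v j) x.
  by apply: (@filter_forall _ _ _ (nbhs (0 : 'rV[R]_n))) => j; exact: (vP j).2.
have near_w : \forall x \near (0 : 'rV[R]_n), forall j,
    val f' x 0 j = val f x 0 j - a x + val (w j) x.
  by apply: (@filter_forall _ _ _ (nbhs (0 : 'rV[R]_n))) => j; exact: (wP j).2.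
have near_f : \forall x \near (0 : 'rV[R]_n), `|val f x| <= r1.
  have /cvgr_norm_le/(_ r1) := pmap_cvg0 cf.
  by rewrite normr0 => /(_ r10).
have [tau1 tau10 tau1P] := near0_enorm (filterI near_v near_w).
have [tau2 tau20 tau2P] := near0_enorm (filterI near_g near_f).
have rad_v : at_radius S d
    [set t | forall j, (norm_on (val (v j)) t < norm_on b t)%E].
  apply: (@filter_forall _ _ _ (at_radius S d)) => j.
  exact/star_norm_lt/(vP j).1.
have rad_w : at_radius S d
    [set t | forall j, (norm_on (val (w j)) t < norm_on b t)%E].
  apply: (@filter_forall _ _ _ (at_radius S d)) => j.
  exact/star_norm_lt/(wP j).1.
have rad : at_radius S d (
    [set t | forall j, (norm_on (val (v j)) t < norm_on b t)%E] `&`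
    [set t | forall j, (norm_on (val (w j)) t < norm_on b t)%E] `&`
    ([set t | (norm_on (val g) t < norm_on (val g0) t)%E] `&`
     ([set t | 0 < t < tau1] `&` [set t | 0 < t < tau2]))).
  by apply: filterI; apply: filterI => //; apply: filterI; exact: small.
apply: filterS rad => t /= [[vt wt] [gt [/andP[t0 t1] /andP[_ t2]]]].
apply: (lt_norm_on (ltW t0) gt) => x xt.
have [fv fw] := tau1P x (le_lt_trans xt t1).
have [kg fx] := tau2P x (le_lt_trans xt t2).
(* The displacement is read off at a coordinate attaining the sup norm, where [norm_shift] applies;
   a zero displacement is covered by [ab]. *)
have uab : ((`|val f x - val f' x| + a x)%:E < norm_on b t)%E.
  have [->|ne0] := eqVneq (val f x - val f' x) 0.
    rewrite normr0 add0r; apply: le_lt_trans (ab t t0 gt).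
    by apply: le_trans (le_norm_on _ xt); rewrite lee_fin ler_norm.
  have [j ->] := norm_row_coord ne0; rewrite !mxE.
  have [pos|neg] := leP (val f' x 0 j) (val f x 0 j).
    apply: le_lt_trans (vt j); apply: le_trans (le_norm_on _ xt).
    by rewrite lee_fin; apply: (norm_shift (fv j) (fw j)).1.
  apply: le_lt_trans (wt j); apply: le_trans (le_norm_on _ xt).
  by rewrite lee_fin; apply: (norm_shift (fv j) (fw j)).2; exact: ltW.
have shift_eq (k y z u : R) : k + y = z -> u - k = y - (z - u) by lra.
have [e e0 [urho ge]] := abu t x _ t0 xt (normr_ge0 _) uab.
exists e => //; split=> //.
have := (rhoP e e0).2 _ _ fx urho.
set D := val h (val f x) - val h (val f' x) =>
  /(le_trans (le_coord_norm D i)) Di.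
(* By [kg], [g x] is coordinate [i] of [h (f x)] minus [kap x], so [g1] differs from [g] only by the
   variation of [h]. *)
have -> : val h (val f' x) 0 i - val kap x = val g x - D 0 i.
  by rewrite !mxE; exact: shift_eq kg.
by apply: le_trans (ler_normB _ _) _; rewrite lerD2l.
Qed.

End Core.

(** * Subbasic neighbourhoods and initial topologies *)

Section Topology.
Variables (R : realType) (Y : Type).
Variables (V : superstructure R) (W : superstructure Y).
Variables (S : nonstandard_extension V W) (d : Y).

Lemma open_tau_subbase n (A : set (G0 S d n)) : tau_subbase S d n A -> open A.
Proof.
move=> sA; exists [set A]; last by rewrite bigcup_set1.
move=> _ ->; exists [fset A]%fset; first by move=> B /fset1P->; rewrite inE.
rewrite predeqE => x; split=> [|Ax B /fset1P->//]; apply.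
exact/fset1P.
Qed.

(** A neighbourhood contains a finite intersection of subbasic sets, and preimages commute with
    intersections. *)
Lemma cvg_tau (T : topologicalType) n (f : T -> G0 S d n) (x : T) :
  (forall A : set (G0 S d n), tau_subbase S d n A -> A (f x) ->
     \forall y \near x, A (f y)) ->
  f y @[y --> x] --> f x.
Proof.
move=> fA A; rewrite {1}(@nbhsE (G0 S d n)) => -[_ [[B sB <-] [C BC Cx]] sUBA].
suff : \forall y \near x, C (f y).
  move=> FC; apply: (@filterS _ (nbhs x) _ (f @^-1` C) (f @^-1` A) _ FC).
  by move=> y Cy; apply: sUBA; exists C.
have /sB [D sD IDeC] := BC; rewrite -IDeC.
apply: (@filter_bigI _ _ _ (fun E => f @^-1` E) (nbhs x)) => E DE.
by apply: fA; [have := sD _ DE; rewrite inE|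
  move: Cx; rewrite -IDeC => /(_ _ DE)].
Qed.

Lemma continuous_initial (T U : topologicalType) (Z : choiceType) (phi : Z -> U)
  (g : T -> initial_topology phi) :
  continuous (fun x => phi (g x)) -> continuous g.
Proof.
move=> /continuousP gc; apply/continuousP => _ [A oA <-].
exact: gc.
Qed.

(** The topology is a tower of initial ones: subspace, pullback along the coordinates, and product
    as a supremum over the projections. *)
Lemma continuous_Gcont (T : topologicalType) n p (g : T -> Gcont S d n p) :
  (forall i, continuous (fun x => germ_coord (val (g x)) i : G0 S d n)) ->
  continuous g.
Proof.
move=> gi; apply: continuous_initial; apply: continuous_initial => x.
by apply/cvg_sup => i; move: x; apply: continuous_initial; exact: gi.
Qed.

Lemma germ_coord_continuous n p i :
  continuous (fun g : Gcont S d n p => germ_coord (val g) i : G0 S d n).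
Proof.
have c1 := @initial_continuous _ _ (set_val : Gcont S d n p -> Gmap S d n p).
have c2 := @initial_continuous _ _ (@germ_coord R n p : germ R n 'rV[R]_p ->
                         prod_topology (fun _ : 'I_p => G0 S d n)).
have c3 := @proj_continuous _ (fun _ : 'I_p => G0 S d n) i.
move=> g.
exact: (continuous_comp (c1 g) (continuous_comp (c2 _) (c3 _))).
Qed.
End Topology.

Theorem proposition10p12 (R : realType) (Y : Type)
    (V : superstructure R) (W : superstructure Y)
    (S : nonstandard_extension V W)
    (I : Type) (infinite_I : infinite_set [set: I]) (satS : saturated S I)
    (n p : nat) (d : Y) (d_inf : positive_infinitesimal S d)
    (h : Gcont S d p p) :
  continuous (lcomp h : Gcont S d n p -> Gcont S d n p).
Proof.
apply: continuous_Gcont => i f; apply: cvg_tau => A sA.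
(* [germ_compE] computes the composite only from a continuous representative of the inner germ. *)
have germ_rep q (g : Gcont S d q p) : exists2 g',
    val g = germ_of g' & continuous_pmap g'.
  have [g' gE cg] := set_valP g; by exists g'.
have [h' hE ch] := germ_rep p h; have [f' fE cf] := germ_rep n f.
rewrite /= hE fE (germ_compE _ cf) => /(lcomp_nbhd d_inf ch cf sA)[B [BP BA]].
(* A finite intersection over [j] of preimages of open sets under the coordinate maps. *)
have nearB : \forall f1 \near f, forall j : 'I_p,
    (B j).1 (germ_coord (val f1) j) /\ (B j).2 (germ_coord (val f1) j).
  apply: (@filter_forall _ _ _ (nbhs f)) => j; have [s1 s2 f1 f2] := BP j.
  rewrite -fE in f1 f2; apply: filterI; apply: germ_coord_continuous;
    by apply: open_nbhs_nbhs; split=> //; exact: open_tau_subbase.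
apply: filterS nearB => f1 f1B /=.
have [f1' f1E cf1] := germ_rep n f1.
by rewrite f1E (germ_compE _ cf1); apply: BA => j; rewrite -f1E.
Qed.
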